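(* Let $C \subsetneq l_\infty^n$ be a convex polyhedral cone with $\mathrm{int}(C)\neq\emptyset$. Then $C$ is injective if and only if both of the following hold: (i) $\mathrm{T}_pC$ is injective for every $p\in\partial C\setminus\mathrm{apex}(C)$. (ii) There is a facet $F\in\mathrm{Facets}^*([-1,1]^n,C)$ such that $-F\notin\mathrm{Facets}^*([-1,1]^n,C)$.
   Context: $l_\infty^n$ denotes $\mathbb{R}^n$ endowed with the metric induced by the maximum norm $\|\cdot\|_\infty$; subsets of $l_\infty^n$ carry the induced metric. A metric space $X$ is called injective if for any metric spaces $A,B$, any isometric embedding $i\colon A\to B$ and any $1$-Lipschitz (i.e. distance nonincreasing) map $f\colon A\to X$, there is a $1$-Lipschitz map $g\colon B\to X$ with $g\circ i=f$. A convex polyhedron in $\mathbb{R}^n$ is a finite intersection of closed half-spaces (with the empty intersection being $\mathbb{R}^n$). A cone is a (nonempty) subset $C\subset\mathbb{R}^n$ such that $x\in C$ implies $\lambda x\in C$ for all $\lambda\ge 0$; a convex polyhedral cone is a convex polyhedron that is also a cone. For a convex polyhedral cone $C$, $\mathrm{apex}(C)$ is the biggest linear subspace of $\mathbb{R}^n$ contained in $C$. For a nonempty convex polyhedron $P$ and $p\in P$, the tangent cone is $\mathrm{T}_pP:=\bigcup_{m\in\mathbb{N}}\bigl(p+m(P-p)\bigr)$. For an $n$-dimensional convex polyhedron $P$, $\mathrm{Facets}(P)$ is the set of its $(n-1)$-dimensional faces, and for a subset $S\subset\mathbb{R}^n$, $\mathrm{Facets}^*(P,S):=\{F\in\mathrm{Facets}(P):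 \mathrm{relint}(F)\cap S\neq\emptyset\}$, where $\mathrm{relint}$ denotes relative interior. $\mathrm{int}$ and $\partial$ denote topological interior and boundary in $\mathbb{R}^n$. *)

(* Defs.v *)
From HB Require Import structures.
From mathcomp Require Import all_boot all_order all_algebra.
From mathcomp Require Import all_classical all_reals all_analysis.
From mathcomp Require Import lra.

Set Implicit Arguments.
Unset Strict Implicit.
Unset Printing Implicit Defensive.

Import Order.TTheory GRing.Theory Num.Theory.
Import numFieldNormedType.Exports.

Local Open Scope classical_set_scope.
Local Open Scope ring_scope.

(* On matrices `|x| is the maximum norm, so this makes 'rV[R]_n the metric
   space l_oo^n. *)
Section matrix_metric.
Context {K : numFieldType} {m n : nat}.

Let dist (x y : 'M[K]_(m, n)) := `|y - x|.

Let dist_ge0 x y : 0 <= dist x y.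
Proof. exact: normr_ge0. Qed.

Let dist_positivity x y : dist x y = 0 -> x = y.
Proof. by move/normr0_eq0/eqP; rewrite subr_eq0 => /eqP. Qed.

Let ballEdist x d : ball x d = [set y | dist x y < d].
Proof.
by rewrite mx_norm_ball; apply/seteqP; split=> y; rewrite /= /dist distrC.
Qed.

HB.instance Definition _ :=
  @PseudoMetric_isMetric.Build K 'M[K]_(m, n)
    dist dist_ge0 dist_positivity ballEdist.

End matrix_metric.

(* The metric induced on a subset, on top of the library's (initial)
   pseudometric structure on the subtype [set_type A]. *)
Section subset_metric.
Context {R : realType} {X : metricType R} (A : set X).

Let dist (x y : set_type A) : R := mdist (set_val x) (set_val y).

Let dist_ge0 x y : 0 <= dist x y.
Proof. exact: mdist_ge0. Qed.

Let dist_positivity x y : dist x y = 0 -> x = y.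
Proof. by move/mdist_positivity/val_inj. Qed.

Let ballEdist x d : ball x d = [set y | dist x y < d].
Proof.
have -> : ball x d = set_val @^-1` ball (set_val x) d by [].
by rewrite ballEmdist.
Qed.

HB.instance Definition _ :=
  @PseudoMetric_isMetric.Build R (set_type A)
    dist dist_ge0 dist_positivity ballEdist.

End subset_metric.

Section injective_metric_spaces.
Context {R : realType}.

Definition isometric_embedding (A B : metricType R) (i : A -> B) : Prop :=
  forall x y, mdist (i x) (i y) = mdist x y.

Definition lipschitz1 (A B : metricType R) (f : A -> B) : Prop :=
  forall x y, mdist (f x) (f y) <= mdist x y.

Definition injective_metric (X : metricType R) : Prop :=
  forall (A B : metricType R) (i : A -> B) (f : A -> X),
    isometric_embedding i -> lipschitz1 f ->
    exists2 g : B -> X, lipschitz1 g & g \o i = f.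

End injective_metric_spaces.

Section polyhedra.
Context {R : realType} {n : nat}.
Implicit Types (a p x y : 'rV[R]_n) (b : R).
Implicit Types C F P S : set 'rV[R]_n.

Definition dot a x : R := \sum_(i < n) a 0 i * x 0 i.

Definition halfspace (h : 'rV[R]_n * R) : set 'rV[R]_n :=
  [set x | dot h.1 x <= h.2].

Definition hyperplane (h : 'rV[R]_n * R) : set 'rV[R]_n :=
  [set x | dot h.1 x = h.2].

Definition convex_polyhedron P : Prop :=
  exists s : seq ('rV[R]_n * R),
    (forall h, h \in s -> h.1 != 0) /\
    P = \bigcap_(h in [set` s]) halfspace h.

Definition cone C : Prop :=
  C !=set0 /\ forall x (l : R), C x -> 0 <= l -> C (l *: x).

Definition convex_polyhedral_cone C : Prop := convex_polyhedron C /\ cone C.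

(* For a convex polyhedral cone this union is itself a linear subspace, hence
   the biggest one contained in C: see [apex_biggest]. *)
Definition apex C : set 'rV[R]_n :=
  \bigcup_(V in [set V : {vspace 'rV[R]_n} | [set` V] `<=` C]) [set` V].

Definition tangent_cone P p : set 'rV[R]_n :=
  \bigcup_(m in [set: nat]) [set p + m%:R *: (x - p) | x in P].

Definition boundary S : set 'rV[R]_n := closure S `\` interior S.

Definition affine_set S : Prop :=
  forall x y (t : R), S x -> S y -> S ((1 - t) *: x + t *: y).

Definition affine_hull S : set 'rV[R]_n :=
  \bigcap_(A in [set A | affine_set A /\ S `<=` A]) A.

(* [has_dim set0 d] never holds. *)
Definition has_dim S (d : nat) : Prop :=
  exists (p : 'rV[R]_n) (V : {vspace 'rV[R]_n}),
    \dim V = d /\ affine_hull S = [set p + v | v in [set` V]].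

Definition relint S : set 'rV[R]_n :=
  @interior (subspace (affine_hull S)) S.

Definition face P F : Prop :=
  F = P \/
  exists h : 'rV[R]_n * R,
    [/\ h.1 != 0, P `<=` halfspace h & F = P `&` hyperplane h].

Definition Facets P : set (set 'rV[R]_n) :=
  [set F | face P F /\ exists2 d, n = d.+1 & has_dim F d].

Definition Facets_star P S : set (set 'rV[R]_n) :=
  [set F | Facets P F /\ relint F `&` S !=set0].

Definition cube : set 'rV[R]_n := [set x | forall i, x 0 i \in `[-1, 1]].

Lemma polyhedral_coneD C x y :
  convex_polyhedral_cone C -> C x -> C y -> C (x + y).
Proof.
have dotD a u v : dot a (u + v) = dot a u + dot a v.
  by rewrite /dot -big_split; apply: eq_bigr => i _; rewrite mxE mulrDr.
have dotZ a (l : R) v : dot a (l *: v) = l * dot a v.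
  rewrite /dot mulr_sumr; apply: eq_bigr => i _.
  by rewrite mxE mulrCA.
move=> [[s [_ CE]] [_ Cl]] Cx Cy.
have {}Cx : C (2 *: x) by exact: Cl.
have {}Cy : C (2 *: y) by exact: Cl.
rewrite CE => h hs.
have : halfspace h (2 *: x) by rewrite CE in Cx; exact: Cx.
have : halfspace h (2 *: y) by rewrite CE in Cy; exact: Cy.
by rewrite /halfspace /= dotD !dotZ; lra.
Qed.

Lemma apex_biggest C : convex_polyhedral_cone C ->
  exists V : {vspace 'rV[R]_n},
    [/\ apex C = [set` V], [set` V] `<=` C &
        forall W : {vspace 'rV[R]_n}, [set` W] `<=` C -> (W <= V)%VS].
Proof.
move=> hC.
pose Q (d : nat) := `[< exists V : {vspace 'rV[R]_n},
  \dim V = d /\ [set` V] `<=` C >].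
have Q0 : exists d, Q d.
  exists 0%N; apply/asboolP; exists 0%VS; rewrite dimv0; split=> // x /=.
  rewrite memv0 => /eqP ->.
  by case: hC => _ [[c Cc] /(_ c 0 Cc (lexx _))]; rewrite scale0r.
have Qb d : Q d -> (d <= \dim (fullv : {vspace 'rV[R]_n}))%N.
  by move=> /asboolP[V [<- _]]; rewrite dimvS ?subvf.
case: (ex_maxnP Q0 Qb) => d /asboolP[V [dV VC]] dmax.
have Vmax (W : {vspace 'rV[R]_n}) : [set` W] `<=` C -> (W <= V)%VS.
  move=> WC.
  have /dmax : Q (\dim (V + W)%VS).
    apply/asboolP; exists (V + W)%VS; split=> // x /= /memv_addP[v vV [w wW ->]].
    by apply: polyhedral_coneD => //; [exact: VC|exact: WC].
  rewrite -dV => le.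
  have /eqP -> : V == (V + W)%VS by rewrite eqEdim addvSl.
  exact: addvSr.
exists V; split=> //; apply/seteqP; split=> [x [W WC xW]|x xV].
  exact: (subvP (Vmax _ WC)).
by exists V.
Qed.

End polyhedra.

Arguments cube {R} n.

(* Main.v *)
Require Import Defs.
From HB Require Import structures.
From mathcomp Require Import all_boot all_order all_algebra.
From mathcomp Require Import all_classical all_reals all_analysis.
From mathcomp Require Import ring lra.

Import Order.TTheory GRing.Theory Num.Theory.
Import numFieldNormedType.Exports.

Local Open Scope classical_set_scope.
Local Open Scope ring_scope.

(** Write e_i for the i-th unit vector.  A subset X of l_oo^n is injective as
soon as it is hyperconvex: balls that are centered in X and meet pairwise have
a common point in X ([hyperconvex_injective]).  Conversely an injective X is
the image of a 1-Lipschitz retraction of l_oo^n ([injective_retraction]), and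
l_oo^n itself is hyperconvex ([hyperconvexT]): a common point of the balls in
l_oo^n can be chosen and then moved into X.  The facets of the cube are its
sides x_i = s with s = 1 or s = -1, and the side
(s, i) belongs to Facets^* of C if and only if C contains a vector whose
largest coordinate in absolute value is the i-th one, strictly, and has
sign s.

Necessity.  If r retracts l_oo^n onto C, then the rescaled retractions onto
p + m(C - p) stay bounded at each point, and a limit point of them for
m -> oo lies in the closed set T_p C ([tangent_cone_hyperconvex]).  For the
facets, let u in C point strictly into the side (s, i).  Distances to t u for
large t show that r cannot decrease s x_i ([retraction_coord]).  If opposite
facets occurred only together, r would preserve the coordinates in the set I
of the directions that occur.  The norm of an interior vector of C is attained
at a coordinate in I; hence adding multiples of a vector x of C whose
I-coordinates are 0 to an interior vector keeps the norm bounded, and x = 0.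
For x in C this applies to x + r(-x), whence -x = r(-x) lies in C.  Thus C is
a linear subspace with interior points, against C being proper
([retraction_unpaired_side]).

Sufficiency.  Let u in C point strictly into the side (s, i) while no vector
of C points strictly into the side (-s, i).  Given balls centered in C that
meet pairwise, let Q be the part of their intersection on which s q_i is
largest.  Take the largest t in [0, 1] for which C meets the homothetic copy
(1 - t) u + t Q, say at p = (1 - t) u + t q, and suppose t < 1.  Then p is not
in the apex, since otherwise q + d s e_i would lie in all the balls for some
d > 0 ([apex_ball_meet_raise]).  Hence a retraction onto T_p C exists if p is a
boundary point; it maps q into Q, because T_p C contains the centers and the
ray through u.  So a point of Q lies in T_p C (if p is interior, any point of
Q does), and moving from p a little towards it remains in C and raises t, a
contradiction ([cone_hyperconvex]). *)

(** * The maximum norm *)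

Section maximum_norm.
Context {R : realType} {n : nat}.
Implicit Types x y : 'rV[R]_n.

Lemma normv_leP x (r : R) : 0 <= r ->
  reflect (forall j, `|x 0 j| <= r) (`|x| <= r).
Proof.
move=> r0; rewrite [`|x|]/Num.Def.normr /= mx_normrE.
apply: (iffP (bigmax_leP _ _ _ _)) => [[_ h] j|h].
  exact: (h (0, j)).
by split=> // -[i j] _ /=; rewrite ord1.
Qed.

Lemma normv_coord x j : `|x 0 j| <= `|x|.
Proof. exact: (normv_leP x _ (normr_ge0 _) (lexx _)). Qed.

Lemma mdist_rV x y : mdist x y = `|x - y|.
Proof. by rewrite distrC. Qed.

Lemma mdist_subset (X : set 'rV[R]_n) (x y : set_type X) :
  mdist x y = `|set_val x - set_val y|.
Proof. by rewrite -mdist_rV. Qed.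

Lemma norm_delta_le1 i : `|delta_mx 0 i : 'rV[R]_n| <= 1.
Proof.
apply/normv_leP => // k; rewrite mxE /=.
by case: eqP => _; rewrite ?normr1 ?normr0.
Qed.

End maximum_norm.

(** * Injectivity, hyperconvexity and retractions *)

Section hyperconvexity.
Context {R : realType} {n : nat}.
Implicit Types (X : set 'rV[R]_n) (G : set ('rV[R]_n * R)).

Definition pairwise_meeting G :=
  forall z w, G z -> G w -> `|z.1 - w.1| <= z.2 + w.2.

Definition hyperconvex X := forall G, G `<=` [set z | X z.1] ->
  pairwise_meeting G -> exists2 c, X c & forall z, G z -> `|c - z.1| <= z.2.

(** An intersection of balls is a product of intervals, so it suffices that
intervals meeting pairwise have a common point, such as the infimum of their
right ends. *)
Lemma hyperconvexT : hyperconvex [set: 'rV[R]_n].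
Proof.
move=> G _ Gm; have [[z0 Gz0]|/nonemptyPn G0] := pselect (G !=set0); last first.
  by exists 0 => // z; rewrite G0.
have lb k w : G w -> lbound [set z.1 0 k + z.2 | z in G] (w.1 0 k - w.2).
  move=> Gw _ [z Gz <-]; have := Gm w z Gw Gz.
  move/(le_trans (normv_coord _ k)); rewrite !mxE => /ler_normlP[_].
  by lra.
exists (\row_k inf [set z.1 0 k + z.2 | z in G]) => // z Gz.
have z2 : 0 <= z.2 by have := Gm z z Gz Gz; rewrite subrr normr0; lra.
apply/normv_leP => // k; rewrite !mxE; apply/ler_normlP; split.
  suff : z.1 0 k - z.2 <= inf [set z.1 0 k + z.2 | z in G] by lra.
  by apply: lb_le_inf; [exists (z0.1 0 k + z0.2), z0|exact: lb].
suff : inf [set z.1 0 k + z.2 | z in G] <= z.1 0 k + z.2 by lra.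
by apply: ge_inf; [exists (z.1 0 k - z.2); exact: lb|exists z].
Qed.

(** Hyperconvexity allows a 1-Lipschitz map to be extended to one more point b:
its value must lie in the balls around the old values y' of points b' with
radius the distance from b to b', and these meet pairwise by the triangle
inequality.  Zorn's lemma, applied to graphs of partial maps on B, does the
rest. *)
Lemma hyperconvex_injective X :
  hyperconvex X -> injective_metric (set_type X).
Proof.
move=> hX A B i f iso_i lip_f.
(* Bounding the distance to f a, instead of requiring the pairs (i a, f a) to
   belong to G, makes P true of the empty graph, the union of the empty chain. *)
pose P (G : set (B * 'rV[R]_n)) :=
  [/\ forall b y, G (b, y) -> X y,
      forall b y b' y', G (b, y) -> G (b', y') -> `|y - y'| <= mdist b b' &
      forall b y a, G (b, y) -> `|y - set_val (f a)| <= mdist b (i a)].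
have [F FP Ftot|G [[GX Glip Gf] Gmax]] := @Zorn_bigcup _ P.
  split=> [b y [G FG Gby]|b y b' y' [G FG Gby] [G' FG' Gby']|b y a [G FG Gby]].
  - by have [h _ _] := FP _ FG; exact: h Gby.
  - have [/(_ _ Gby)|/(_ _ Gby')] := Ftot _ _ FG FG'.
      by move=> G'by; have [_ h _] := FP _ FG'; exact: h.
    by move=> Gby''; have [_ h _] := FP _ FG; exact: h.
  - by have [_ _ h] := FP _ FG; exact: h.
have Gtot b : exists y, G (b, y).
  have [y Xy yG] : exists2 y, X y &
      (forall b' y', G (b', y') -> `|y - y'| <= mdist b b') /\
      (forall a, `|y - set_val (f a)| <= mdist b (i a)).
    pose D := [set z : 'rV[R]_n * R |
       (exists2 w, G w & z = (w.2, mdist b w.1)) \/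
       exists a, z = (set_val (f a), mdist b (i a))].
    have [|z w zD wD|y Xy Dy] := hX D.
    - move=> _ [[[b' y'] Gw ->]|[a ->]] /=; first exact: GX Gw.
      exact: set_valP.
    - have tri (c c' : B) : mdist c c' <= mdist b c + mdist b c'.
        by rewrite [mdist b c]metric_sym; exact: metric_triangle.
      case: zD => [[[b1 y1] /= G1 ->]|[a1 ->]];
        case: wD => [[[b2 y2] /= G2 ->]|[a2 ->]] /=; apply: le_trans (tri _ _).
      + exact: Glip.
      + exact: Gf.
      + by rewrite distrC metric_sym; exact: Gf.
      + by rewrite -mdist_subset iso_i; exact: lip_f.
    - exists y => //; split=> [b' y' G'|a].
        by have := Dy (y', mdist b b'); apply; left; exists (b', y').
      have := Dy (set_val (f a), mdist b (i a)).
      by apply; right; exists a.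
  exists y; apply: contrapT => nGby.
  apply: (Gmax (G `|` [set (b, y)])).
    split; first by move=> w; left.
    by move=> /(_ (b, y)); apply: contra_not nGby; apply; right.
  split=> [c z [/GX //|[_ ->]] //|c z c' z'|c z a [|[-> ->]]]; last exact: yG.2.
    move=> [Gcz|[-> ->]] [Gcz'|[-> ->]]; [exact: Glip| |exact: yG.1|].
      by rewrite distrC metric_sym; exact: yG.1.
    by rewrite subrr normr0 mdistxx.
  exact: Gf.
have [g Gg] := choice Gtot.
exists (fun b => SigSub (mem_set (GX _ _ (Gg b)))).
  by move=> b b'; rewrite mdist_subset; exact: Glip.
apply/funext => a /=; apply/val_inj => /=.
apply/eqP; rewrite -subr_eq0 -normr_le0 -(mdistxx (i a)).
exact: Gf (Gg _).
Qed.

Definition retraction X (r : 'rV[R]_n -> 'rV[R]_n) :=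
  [/\ forall x, X (r x), forall x, X x -> r x = x &
      forall x y, `|r x - r y| <= `|x - y|].

Lemma injective_retraction X :
  injective_metric (set_type X) -> exists r, retraction X r.
Proof.
move=> /(_ (set_type X) 'rV[R]_n set_val id)[//|//|g glip gid].
exists (set_val \o g); split=> [x|x Xx|x y] /=; first exact: set_valP.
  by have /(congr1 (fun h => set_val (h (SigSub (mem_set Xx))))) := gid.
by rewrite -mdist_subset -mdist_rV; exact: glip.
Qed.

End hyperconvexity.

(** * Convex polyhedra and their tangent cones *)

Section polyhedra.
Context {R : realType} {n : nat}.
Implicit Types (a p x y z : 'rV[R]_n) (P C : set 'rV[R]_n).

Lemma dotD a x y : dot a (x + y) = dot a x + dot a y.
Proof.
by rewrite /dot -big_split; apply: eq_bigr => i _; rewrite mxE mulrDr.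
Qed.

Lemma dotZ a (l : R) x : dot a (l *: x) = l * dot a x.
Proof.
by rewrite /dot mulr_sumr; apply: eq_bigr => i _; rewrite mxE mulrCA.
Qed.

Lemma dotB a x y : dot a (x - y) = dot a x - dot a y.
Proof. by rewrite -scaleN1r dotD dotZ mulN1r. Qed.

Lemma dot_continuous a : continuous (dot a).
Proof.
have aj j : continuous (fun x => a 0 j * x 0 j).
  by move=> x; exact: (cvgM (cvg_cst _) (@coord_continuous R 1 n 0 j x)).
have add : continuous (fun z : R * R => z.1 + z.2) by exact: add_continuous.
exact: (continuous_big add (fun j _ => aj j)).
Qed.

Lemma closed_sublevel (T : topologicalType) (f : T -> R) (b : R) :
  continuous f -> closed [set x | f x <= b].
Proof.
move=> /continuous_closedP fP.
by apply: (fP [set y | y <= b]); exact: closed_le.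
Qed.

Lemma closed_polyhedron P : convex_polyhedron P -> closed P.
Proof.
move=> [s [_ ->]]; apply: closed_bigI => h _.
exact: closed_sublevel (dot_continuous _).
Qed.

Lemma closed_norm_ball z (r : R) : closed [set x | `|x - z| <= r].
Proof.
apply: closed_sublevel => x; apply: (@continuous_comp _ _ _ (fun x => x - z)).
  exact: (cvgB cvg_id (cvg_cst _)).
exact: norm_continuous.
Qed.

Lemma bounded_norm_ball z (r : R) : bounded_set [set x | `|x - z| <= r].
Proof.
exists (r + `|z|); split=> [|M rM x /= xz]; first exact: num_real.
apply: le_trans (ltW rM).
by rewrite -lerBlDr; apply: le_trans xz; exact: lerB_dist.
Qed.

Lemma compact_norm_ball z (r : R) : compact [set x | `|x - z| <= r].
Proof.
apply: bounded_closed_compact; first exact: bounded_norm_ball.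
exact: closed_norm_ball.
Qed.

Lemma interior_normP P x :
  interior P x <-> exists2 e : R, 0 < e & forall y, `|y - x| < e -> P y.
Proof.
have -> : interior P x <-> nbhs_ball x P by rewrite -nbhs_ballP.
split=> -[e e0 h]; exists e => // y.
  by move=> yx; apply: h; rewrite mx_norm_ball /= distrC.
by rewrite mx_norm_ball /= distrC; exact: h.
Qed.

Lemma polyhedron_convex P (t : R) x y : convex_polyhedron P ->
  0 <= t <= 1 -> P x -> P y -> P ((1 - t) *: x + t *: y).
Proof.
move=> [s [_ ->]] /andP[t0 t1] Px Py h hs.
have {Px} := Px h hs; have {Py} := Py h hs.
by rewrite /halfspace /= dotD !dotZ; nra.
Qed.

Lemma sub_tangent_cone P p : P `<=` tangent_cone P p.
Proof.
by move=> x Px; exists 1%N => //; exists x; rewrite // scale1r addrC subrK.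
Qed.

(** Only the constraints that are active at p survive in the tangent cone: a
constraint with slack at p holds at p + (x - p) / m once m is large, and
finitely many constraints have a common such m. *)
Lemma tangent_coneE (s : seq ('rV[R]_n * R)) P p :
  P = \bigcap_(h in [set` s]) halfspace h -> P p ->
  tangent_cone P p =
  \bigcap_(h in [set h | h \in s /\ dot h.1 p = h.2]) halfspace h.
Proof.
move=> PE Pp; apply/seteqP; split=> [_ [m _ [y Py <-]] h [hs hp]|x xh].
  rewrite /halfspace /= dotD dotZ dotB hp.
  have : dot h.1 y <= h.2 by rewrite PE in Py; exact: Py.
  by have := ler0n R m; nra.
have [M hM] : exists M : nat, forall h, h \in s ->
    dot h.1 x - dot h.1 p <= M.+1%:R * (h.2 - dot h.1 p).
  have {PE}: forall h, h \in s -> dot h.1 p <= h.2 by rewrite PE in Pp.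
  have {xh}: forall h, h \in s -> dot h.1 p = h.2 -> dot h.1 x <= h.2.
    by move=> h hs hp; exact: xh.
  elim: s => [|h s IHs] sx sp; first by exists 0%N.
  have [M hM] : exists M : nat, forall h, h \in s ->
      dot h.1 x - dot h.1 p <= M.+1%:R * (h.2 - dot h.1 p).
    by apply: IHs => g gs; [apply: sx|apply: sp]; rewrite inE gs orbT.
  have hs : h \in h :: s by rewrite inE eqxx.
  have [M' hM'] : exists M' : nat,
      dot h.1 x - dot h.1 p <= M'.+1%:R * (h.2 - dot h.1 p).
    have := sp h hs; rewrite le_eqVlt => /predU1P[hp|hp].
      by exists 0%N; have := sx h hs hp; lra.
    exists (Num.Def.trunc ((dot h.1 x - dot h.1 p) / (h.2 - dot h.1 p))).
    by rewrite -ler_pdivrMr ?subr_gt0 //; exact/ltW/truncnS_gt.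
  exists (M + M')%N => g; rewrite inE => /orP[/eqP->|gs].
    apply: le_trans hM' _; rewrite ler_wpM2r ?subr_ge0 ?sp //.
    by rewrite ler_nat ltnS leq_addl.
  apply: le_trans (hM _ gs) _.
  rewrite ler_wpM2r ?subr_ge0 ?sp ?inE ?gs ?orbT //.
  by rewrite ler_nat ltnS leq_addr.
exists M.+1 => //; exists (p + M.+1%:R^-1 *: (x - p)); last first.
  by rewrite addrAC subrr add0r scalerA divff ?pnatr_eq0 // scale1r addrC subrK.
rewrite PE => h hs; rewrite /halfspace /= dotD dotZ dotB.
by rewrite -lerBrDl mulrC ler_pdivrMr ?ltr0n // mulrC hM.
Qed.

Lemma closed_tangent_cone P p :
  convex_polyhedron P -> P p -> closed (tangent_cone P p).
Proof.
move=> [s [_ PE]] Pp; rewrite (tangent_coneE _ _ _ PE Pp).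
by apply: closed_bigI => h _; exact: closed_sublevel (dot_continuous _).
Qed.

Lemma cluster_closed (T : topologicalType) (F : set_system T) (E : set T)
    (c : T) :
  closed E -> F E -> cluster F c -> E c.
Proof. by move=> Ecl FE cF; apply: Ecl => B; exact: cF. Qed.

(** The tangent cone is the increasing union of the sets p + m(P - p), onto
each of which r can be conjugated.  If q lies in all the balls, so does its
image under the m-th conjugate as far as the centers already belong to the m-th
set, and a limit point of these images lies in all of them. *)
Lemma tangent_cone_hyperconvex P p r : convex_polyhedron P -> P p ->
  retraction P r -> hyperconvex (tangent_cone P p).
Proof.
move=> hP Pp [rP rid rlip] G GT /hyperconvexT[//|q _ qG].
(* Using m.+1 instead of m avoids the division by 0. *)
pose c (m : nat) := p + m.+1%:R *: (r (p + m.+1%:R^-1 *: (q - p)) - p).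
have m1 m : 0 < m.+1%:R :> R by rewrite ltr0n.
have cdist m y : P y ->
    `|c m - (p + m.+1%:R *: (y - p))| <= `|q - (p + m.+1%:R *: (y - p))|.
  move=> Py; have -> : c m - (p + m.+1%:R *: (y - p)) =
      m.+1%:R *: (r (p + m.+1%:R^-1 *: (q - p)) - r y).
    by rewrite (rid y Py) /c; apply/rowP => j; rewrite !mxE; ring.
  have -> : q - (p + m.+1%:R *: (y - p)) =
      m.+1%:R *: (p + m.+1%:R^-1 *: (q - p) - y).
    by apply/rowP => j; rewrite !mxE; field; rewrite nat1r gt_eqF.
  by rewrite !normrZ ler_wpM2l ?normr_ge0 //; exact: rlip.
have cball z : tangent_cone P p z ->
    \forall m \near \oo, `|c m - z| <= `|q - z|.
  move=> [k _ [y Py <-]]; exists k => // m /= km.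
  have -> : p + k%:R *: (y - p) =
      p + m.+1%:R *: ((1 - k%:R / m.+1%:R) *: p + (k%:R / m.+1%:R) *: y - p).
    by apply/rowP => j; rewrite !mxE; field; rewrite nat1r gt_eqF.
  apply: cdist; apply: polyhedron_convex => //.
  by rewrite divr_ge0 // ler_pdivrMr // mul1r ler_nat leqW.
have [a [_ ac]] : exists a,
    ([set x | `|x - p| <= `|q - p|] `&` cluster (c @ \oo)) a.
  apply: (compact_norm_ball p `|q - p|).
  by apply: cball; exact: sub_tangent_cone Pp.
exists a.
  apply: (cluster_closed _ _ _ _ (closed_tangent_cone _ _ hP Pp) _ ac).
  exists 0%N => // m _; exists m.+1 => //.
  by exists (r (p + m.+1%:R^-1 *: (q - p))).
move=> z Gz; apply: (cluster_closed _ _ _ _ (closed_norm_ball _ _) _ ac).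
by apply: filterS (cball _ (GT z Gz)) => m /le_trans; apply; exact: qG.
Qed.

Lemma tangent_cone_segment P p z : P p -> tangent_cone P p z ->
  exists2 t : R, 0 < t <= 1 & P ((1 - t) *: p + t *: z).
Proof.
move=> Pp [[|m] _ [y Py <-]].
  exists 1; first by rewrite ltr01 lexx.
  by rewrite subrr scale0r add0r scale1r scale0r addr0.
exists m.+1%:R^-1; first by rewrite invr_gt0 ltr0n /= invf_le1 ?ltr0n // ler1n.
rewrite scalerDr scalerA mulVf ?pnatr_eq0 // scale1r addrA -scalerDl subrK.
by rewrite scale1r addrC subrK.
Qed.

End polyhedra.

(** * The sides of the cube *)

Section cube_sides.
Context {R : realType} {n : nat}.
Implicit Types (x y u v : 'rV[R]_n) (s : R) (i j : 'I_n) (A S F : set 'rV[R]_n).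

(** The sides of the cube are indexed by a coordinate i and a sign s with
s * s = 1, so that the condition x_i = s reads s * x_i = 1. *)
Definition side s i : set 'rV[R]_n := cube n `&` [set x | s * x 0 i = 1].

Definition open_side s i : set 'rV[R]_n :=
  [set x | s * x 0 i = 1 /\ forall j, j != i -> `|x 0 j| < 1].

Lemma sign_norm1 s : s * s = 1 -> `|s| = 1.
Proof. by move=> ss; rewrite -sqrtr_sqr expr2 ss sqrtr1. Qed.

Lemma cubeP x : cube n x <-> forall j, `|x 0 j| <= 1.
Proof. by split=> h j; have := h j; rewrite in_itv /= ler_norml. Qed.

Lemma sign_mulE s (a : R) : s * s = 1 -> s * a = 1 <-> a = s.
Proof.
move=> ss; split=> [sa|->//].
by rewrite -[a]mul1r -ss -mulrA sa mulr1.
Qed.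

Lemma side_cond_affine s i : affine_set [set x : 'rV[R]_n | s * x 0 i = 1].
Proof.
move=> x y t /= xi yi; rewrite !mxE.
have -> : s * ((1 - t) * x 0 i + t * y 0 i) =
  (1 - t) * (s * x 0 i) + t * (s * y 0 i) by ring.
by rewrite xi yi; ring.
Qed.

(** A point x of A lies on the line through c and a point of S obtained by
shrinking x towards c. *)
Lemma affine_hull_absorb S A c : affine_set A -> S `<=` A -> S c ->
    (forall x, A x ->
       exists2 M : R, M != 0 & S (c + M^-1 *: (x - c))) ->
  affine_hull S = A.
Proof.
move=> Aaff SA Sc absorb; apply/seteqP; split=> [x|x Ax B [Baff SB]].
  by apply.
have [M M0 Sx] := absorb x Ax.
have -> : x = (1 - M) *: c + M *: (c + M^-1 *: (x - c)).
  by apply/rowP => j; rewrite !mxE; field.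
by apply: Baff; apply: SB.
Qed.

Lemma affine_hull_cube : affine_hull (cube n) = [set: 'rV[R]_n].
Proof.
apply: (@affine_hull_absorb _ _ 0) => // [|x _].
  by apply/cubeP => j; rewrite mxE normr0.
have M0 : 0 < 1 + `|x| by rewrite ltr_wpDr.
exists (1 + `|x|); first by rewrite gt_eqF.
apply/cubeP => j; rewrite !mxE subr0 add0r normrM normfV (gtr0_norm M0).
by rewrite ler_pdivrMl // mulr1 ler_wpDl // normv_coord.
Qed.

Lemma side_center s i : s * s = 1 -> open_side s i (s *: delta_mx 0 i).
Proof.
move=> ss; split=> [|j ji]; rewrite !mxE !eqxx /= ?mulr1n.
  by rewrite mulr1.
by rewrite (negPf ji) mulr0 normr0.
Qed.

Lemma open_side_sub s i : s * s = 1 -> open_side s i `<=` side s i.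
Proof.
move=> ss x [xi xj]; split=> //; apply/cubeP => j.
have [->|/xj/ltW//] := eqVneq j i.
by rewrite ((sign_mulE _ _ ss).1 xi) sign_norm1.
Qed.

Lemma affine_hull_side s i : s * s = 1 ->
  affine_hull (side s i) = [set x | s * x 0 i = 1].
Proof.
move=> ss; apply: (@affine_hull_absorb _ _ (s *: delta_mx 0 i)).
- exact: side_cond_affine.
- by move=> x [].
- exact/open_side_sub/side_center.
move=> x /= xi.
have M0 : 0 < 1 + `|x| by rewrite ltr_wpDr.
exists (1 + `|x|); first by rewrite gt_eqF.
apply: open_side_sub => //; split=> [|j ji]; rewrite !mxE !eqxx /=.
  by rewrite mulr1n mulr1 ((sign_mulE _ _ ss).1 xi) subrr mulr0 addr0.
rewrite (negPf ji) mulr0 subr0 add0r normrM normfV (gtr0_norm M0).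
by rewrite ltr_pdivrMl // mulr1 ltr_pwDl // normv_coord.
Qed.

Lemma open_side_gap s i u : open_side s i u ->
  exists e : R, [/\ 0 < e, e <= 1 & forall j, j != i -> `|u 0 j| + e <= 1].
Proof.
move=> [_ uj]; exists (\big[Order.min/1]_(j | j != i) (1 - `|u 0 j|)); split.
- by apply/bigmin_gtP; split=> [|j /uj]; rewrite ?ltr01 ?subr_gt0.
- exact: bigmin_le_id.
- by move=> j ji; rewrite addrC -lerBrDr; apply: bigmin_le_cond.
Qed.

(** In the hyperplane x_i = s, the side is cut out by the conditions on the
other coordinates, so its relative interior is where these hold strictly. *)
Lemma relint_side s i : s * s = 1 -> relint (side s i) = open_side s i.
Proof.
move=> ss; have hullE := affine_hull_side _ i ss.
have inE x : side s i x -> affine_hull (side s i) x by move=> h A [_]; apply.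
apply/seteqP; split=> x.
  move=> xr; have xs : side s i x by exact: (interior_subset xr).
  split=> [|j ji]; first exact: xs.2.
  rewrite lt_neqAle (cubeP x).1 ?andbT; last exact: xs.1.
  apply/eqP => xj.
  have : within (affine_hull (side s i)) (nbhs x) (side s i).
    by rewrite (nbhs_subspace_in (inE _ xs)).
  have -> : within (affine_hull (side s i)) (nbhs x) (side s i) <->
     interior [set y | affine_hull (side s i) y -> side s i y] x by [].
  (* A coordinate x_j = 1 or -1 can be pushed out of the cube. *)
  move=> /interior_normP[e e0 /(_ (x + (e / 2) *: (x 0 j *: delta_mx 0 j)))].
  rewrite addrAC subrr add0r !normrZ xj hullE /=.
  have dj := @norm_delta_le1 R n j.
  have e2 : `|e / 2| = e / 2 by rewrite gtr0_norm // divr_gt0.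
  case; first by rewrite -normrM e2 mul1r; nra.
    by rewrite !mxE eqxx eq_sym (negPf ji) /= !mulr0 addr0; exact: xs.2.
  move=> /cubeP/(_ j); rewrite !mxE !eqxx /= mulr1.
  have -> : x 0 j + e / 2 * x 0 j = (1 + e / 2) * x 0 j by ring.
  by rewrite normrM xj mulr1 gtr0_norm; lra.
move=> [xi xj].
have xs : side s i x by exact: open_side_sub.
suff : within (affine_hull (side s i)) (nbhs x) (side s i).
  by rewrite (nbhs_subspace_in (inE _ xs)).
suff : interior [set y | affine_hull (side s i) y -> side s i y] x by [].
have [e [e0 _ ej]] := open_side_gap _ _ _ (conj xi xj).
apply/interior_normP; exists e => // y yx; rewrite hullE => yi; split=> //.
apply/cubeP => j; have [->|ji] := eqVneq j i.
  by rewrite ((sign_mulE _ _ ss).1 yi) sign_norm1.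
have := ej j ji; have := normv_coord (y - x) j; rewrite !mxE => h1 h2.
have := lerB_dist (y 0 j) (x 0 j); lra.
Qed.

Lemma opp_side s i : [set - x | x in side s i] = side (- s) i.
Proof.
apply/seteqP; split=> [_ [x [/cubeP xc xi] <-]|x [/cubeP xc xi]].
  by split; [apply/cubeP => j|]; rewrite /= !mxE ?normrN // mulrNN.
exists (- x); last by rewrite opprK.
by split; [apply/cubeP => j|]; rewrite /= !mxE ?normrN // mulrN -mulNr.
Qed.

Lemma coordinate_hyperplane i : exists W : {vspace 'rV[R]_n},
  (\dim W).+1 = n /\ forall v, v \in W = (v 0 i == 0).
Proof.
pose f : 'Hom('rV[R]_n, 'rV[R]_1) := linfun (mulmxr (delta_mx i 0)).
have fE v : f v 0 0 = v 0 i by rewrite lfunE /= -colE mxE.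
have WE v : v \in lker f = (v 0 i == 0).
  rewrite memv_ker; apply/eqP/eqP => [fv|vi]; first by rewrite -fE fv mxE.
  by apply/rowP => k; rewrite ord1 fE vi mxE.
exists (lker f); split=> //.
have := limg_ker_dim f fullv; rewrite capfv dimvf /= /dim /= mul1n.
have : (\dim (limg f) <= 1)%N by rewrite (leq_trans (dimvS (subvf _))) // dimvf.
have : \dim (limg f) != 0%N.
  rewrite dimv_eq0; apply/eqP => f0.
  have : f (delta_mx 0 i) \in limg f by rewrite memv_img ?memvf.
  rewrite f0 memv0 => /eqP/rowP/(_ 0); rewrite fE !mxE !eqxx => /eqP.
  by rewrite oner_eq0.
by case: (\dim (limg f)) => [|[|//]] // _ _; rewrite addn1.
Qed.

End cube_sides.

(** * The sides are the facets of the cube *)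

Section cube_facets.
Context {R : realType} {n : nat}.
Implicit Types (x y v : 'rV[R]_n) (s : R) (i j : 'I_n) (C F : set 'rV[R]_n).

Lemma side_facet s i : s * s = 1 -> Facets (cube n) (side s i).
Proof.
move=> ss; have dotE x : dot (s *: delta_mx 0 i) x = s * x 0 i.
  rewrite /dot (bigD1 i) //= !mxE !eqxx mulr1 big1 ?addr0 // => j ji.
  by rewrite !mxE (negPf ji) andbF mulr0 mul0r.
split.
  right; exists (s *: delta_mx 0 i, 1); split=> /=.
  - apply/eqP => /rowP/(_ i); rewrite !mxE !eqxx mulr1 => s0.
    by move: ss; rewrite s0 mul0r => /eqP; rewrite eq_sym oner_eq0.
  - move=> x /cubeP/(_ i) xi; rewrite /halfspace /= dotE.
    by rewrite (le_trans (ler_norm _)) // normrM sign_norm1 // mul1r.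
  - by apply/seteqP; split=> x [xc xi]; split=> //; move: xi;
      rewrite /hyperplane /= dotE.
have [W [dW WE]] := @coordinate_hyperplane R n i.
exists (\dim W); first by rewrite dW.
exists (s *: delta_mx 0 i), W; split=> //; rewrite affine_hull_side //.
have ci : (s *: delta_mx 0 i : 'rV[R]_n) 0 i = s by rewrite !mxE !eqxx mulr1.
apply/seteqP; split=> [x xi|_ [v vW <-]] /=.
  exists (x - s *: delta_mx 0 i); last by rewrite addrC subrK.
  rewrite /= WE [X in X == 0]mxE [X in _ + X]mxE ci.
  by rewrite ((sign_mulE _ _ ss).1 xi) subrr.
by move: vW => /=; rewrite WE mxE ci => /eqP ->; rewrite addr0.
Qed.

Lemma cube_not_facet d : n = d.+1 -> ~ has_dim (cube n) (R := R) d.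
Proof.
move=> nd [p [V [dV]]]; rewrite affine_hull_cube => VE.
have : (fullv <= V)%VS.
  apply/subvP => v _; have : [set: 'rV[R]_n] (p + v) by [].
  by rewrite VE => -[w wV /addrI <-].
by move=> /dimvS; rewrite dV dimvf /dim /= mul1n nd ltnn.
Qed.

(** A supporting hyperplane with normal a meets the cube only in points with
x_k = sgn(a_k) whenever a_k is nonzero, since otherwise replacing x_k by
sgn(a_k) would leave the half-space.  Each such k confines the direction space
of the facet to the hyperplane v_k = 0; as its dimension is n - 1, only one k
is possible. *)
Lemma facet_side F : Facets (cube n) F -> exists s i, s * s = 1 /\ F = side s i.
Proof.
move=> [faceF [d nd dimF]].
case: faceF dimF => [->|[[a b] /= [a0 cubeab FE]]].
  by move/(cube_not_facet _ nd).
move=> [p [V [dV VE]]].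
have [x Fx] : F !=set0.
  apply/set0P/eqP => F0; have : [set p + v | v in [set` V]] p.
    by exists 0; rewrite /= ?mem0v // addr0.
  by rewrite -VE F0 => /(_ set0); apply; split=> // ? ? ? [].
have Fab y : F y -> dot a y = b by rewrite FE => -[].
have Fcube y : F y -> cube n y by rewrite FE => -[].
have sgE k : a 0 k != 0 -> Num.sg (a 0 k) * Num.sg (a 0 k) = 1.
  by move=> ak; rewrite -expr2 sqr_sg ak.
have Fside k : a 0 k != 0 -> F `<=` [set y | Num.sg (a 0 k) * y 0 k = 1].
  move=> ak y Fy /=; have ss := sgE k ak.
  set s := Num.sg (a 0 k) in ss *.
  have akE : a 0 k = s * `|a 0 k| by rewrite -numEsg.
  pose y' := y + (s - y 0 k) *: delta_mx 0 k.
  have y'c : cube n y'.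
    apply/cubeP => j; rewrite !mxE /=; have [->|jk] := eqVneq j k.
      by rewrite mulr1 addrC subrK sign_norm1.
    by rewrite mulr0 addr0; exact: ((cubeP y).1 (Fcube _ Fy)).
  have := cubeab _ y'c; rewrite /halfspace /= dotD dotZ (Fab _ Fy).
  have -> : dot a (delta_mx 0 k) = a 0 k.
    rewrite /dot (bigD1 k) //= !mxE !eqxx mulr1 big1 ?addr0 // => j jk.
    by rewrite mxE (negPf jk) andbF mulr0.
  rewrite gerDl akE mulrA mulrBl ss pmulr_lle0 ?normr_gt0 //.
  rewrite subr_le0 mulrC => h.
  apply/eqP; rewrite eq_le h andbT.
  have /cubeP/(_ k) yk := Fcube _ Fy.
  by rewrite (le_trans (ler_norm _)) // normrM sign_norm1 // mul1r.
have Vcoord k : a 0 k != 0 -> forall v, v \in V -> v 0 k = 0.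
  move=> ak v vV.
  have hull : [set p + v | v in [set` V]] `<=`
      [set y | Num.sg (a 0 k) * y 0 k = 1].
    by rewrite -VE => y /(_ _ (conj (side_cond_affine _ _) (Fside k ak))).
  have pk : Num.sg (a 0 k) * (p + v) 0 k = 1 by apply: hull; exists v.
  have p0 : Num.sg (a 0 k) * (p + 0) 0 k = 1.
    by apply: hull; exists 0; rewrite /= ?mem0v.
  have /(sign_mulE _ _ (sgE k ak)) := pk.
  have /(sign_mulE _ _ (sgE k ak)) := p0.
  by rewrite !mxE addr0 => ->; rewrite -[RHS]addr0 => /addrI.
have [k ak] : exists k, a 0 k != 0.
  apply/not_existsP => h; move/negP: a0; apply; apply/eqP/rowP => k.
  by rewrite mxE; apply/eqP; have /negP := h k; rewrite negbK.
have [W [dW WE]] := @coordinate_hyperplane R n k.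
have VW : V = W.
  apply/eqP; rewrite eqEdim; apply/andP; split.
    by apply/subvP => v /(Vcoord k ak) vk; rewrite WE vk.
  by rewrite dV -ltnS dW nd.
have aj j : j != k -> a 0 j = 0.
  move=> jk; apply: contrapT => /eqP /Vcoord/(_ (delta_mx 0 j)).
  rewrite VW WE !mxE !eqxx [k == j]eq_sym (negPf jk) eqxx => /(_ erefl) /eqP.
  by rewrite oner_eq0.
exists (Num.sg (a 0 k)), k; split; first exact: sgE.
apply/seteqP; split=> y; first by move=> Fy; split; [exact: Fcube|exact: Fside].
move=> [yc yk]; rewrite FE; split=> //; rewrite /hyperplane /= -(Fab _ Fx) /dot.
apply: eq_bigr => j _; have [->|/aj->] := eqVneq j k; last by rewrite !mul0r.
have ss := sgE k ak; congr (_ * _); apply: etrans ((sign_mulE _ _ ss).1 yk) _.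
exact/esym/(sign_mulE _ _ ss)/Fside.
Qed.

Lemma Facets_star_side C s i : s * s = 1 ->
  Facets_star (cube n) C (side s i) <-> open_side s i `&` C !=set0.
Proof.
move=> ss; rewrite /Facets_star /= relint_side //; split=> [[]//|]; split=> //.
exact: side_facet.
Qed.

End cube_facets.

(** * Retractions onto cones *)

Section retractions_onto_cones.
Context {R : realType} {n : nat}.
Implicit Types (x y u : 'rV[R]_n) (s : R) (i j : 'I_n) (C X : set 'rV[R]_n).

(** For large t, the distance from x to t u is t - s x_i, because the i-th
coordinate of u strictly dominates; as r fixes t u, the i-th coordinate of r x
is at least as close to that of t u. *)
Lemma retraction_coord X r s i u x : s * s = 1 -> retraction X r ->
  open_side s i u -> (forall t, 0 <= t -> X (t *: u)) ->
  s * x 0 i <= s * r x 0 i.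
Proof.
move=> ss [_ rid rlip] us Xu; have [e [e0 _ ue]] := open_side_gap _ _ _ us.
have uiE := (sign_mulE _ _ ss).1 us.1.
(* The coordinates j <> i of x - t u are at most |x| + t (1 - e), which is at most
   t - |x| if t e >= 2 |x|; the summand |x| ensures t >= s x_i. *)
pose t := 2 * `|x| / e + `|x|.
have x0 : 0 <= `|x| := normr_ge0 x.
have te : 0 <= 2 * `|x| / e by rewrite divr_ge0 ?mulr_ge0 // ltW.
have t0 : 0 <= t by rewrite addr_ge0.
have sx : s * x 0 i <= `|x|.
  by rewrite (le_trans (ler_norm _)) // normrM sign_norm1 // mul1r normv_coord.
have : `|x - t *: u| <= t - s * x 0 i.
  apply/normv_leP => [|j]; first by rewrite /t; lra.
  rewrite !mxE; have [->|ji] := eqVneq j i.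
    rewrite uiE -[_ - _]mul1r -ss -mulrA normrM sign_norm1 // mul1r.
    rewrite mulrBr mulrCA ss mulr1.
    by rewrite distrC ger0_norm // /t; lra.
  have tue : t * (`|u 0 j| + e) <= t by rewrite ler_piMr // ue.
  have : t * e = 2 * `|x| + `|x| * e by rewrite /t mulrDl divfK // gt_eqF.
  have := ler_normB (x 0 j) (t * u 0 j).
  rewrite [`|t * _|]normrM (ger0_norm t0).
  have := normv_coord x j; have := mulr_ge0 x0 (ltW e0).
  by move: tue; rewrite mulrDr; lra.
move=> /(le_trans (rlip _ _)); rewrite (rid _ (Xu t t0)).
move=> /(le_trans (normv_coord _ i)); rewrite !mxE uiE.
rewrite -[_ - _]mul1r -ss -mulrA normrM sign_norm1 // mul1r.
rewrite mulrBr mulrCA ss mulr1.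
by move=> /ler_normlP[]; lra.
Qed.

Lemma interior_coneD C x u : convex_polyhedral_cone C ->
  C x -> interior C u -> interior C (x + u).
Proof.
move=> hC Cx /interior_normP[e e0 eC].
apply/interior_normP; exists e => // y ye.
rewrite -[y](subrK x) addrC; apply: polyhedral_coneD => //.
by apply: eC; rewrite -addrA -opprD.
Qed.

(** Increasing the absolute value of a maximal coordinate of u makes it strictly
dominant; the perturbed vector stays in C and can be normalized. *)
Lemma interior_cone_open_side C u i : convex_polyhedral_cone C ->
  interior C u -> (forall j, `|u 0 j| <= `|u 0 i|) ->
  exists2 s, s * s = 1 & open_side s i `&` C !=set0.
Proof.
move=> [_ [_ Cl]] /interior_normP[e e0 eC] umax.
have [s ss su] : exists2 s : R, s * s = 1 & s * u 0 i = `|u 0 i|.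
  by case: (ger0P (u 0 i)) => _; [exists 1|exists (-1)];
    rewrite ?mulN1r ?opprK ?mul1r.
exists s => //.
have c0 : 0 < `|u 0 i| + e / 2 by rewrite ltr_wpDl // divr_gt0.
exists ((`|u 0 i| + e / 2)^-1 *: (u + (e / 2 * s) *: delta_mx 0 i)); split.
  split=> [|j ji]; rewrite !mxE !eqxx /=.
    by rewrite mulr1 mulrCA mulrDr mulrCA ss mulr1 su mulVf // gt_eqF.
  rewrite (negPf ji) mulr0 addr0 normrM normfV (gtr0_norm c0) mulrC.
  by rewrite ltr_pdivrMr // mul1r (le_lt_trans (umax j)) // ltrDl divr_gt0.
apply: Cl; last by rewrite invr_ge0 ltW.
apply: eC; rewrite addrAC subrr add0r normrZ normrM (sign_norm1 _ ss) mulr1.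
have := @norm_delta_le1 R n i.
by rewrite gtr0_norm ?divr_gt0 //; nra.
Qed.

(** If sides occurred only in opposite pairs, a retraction would preserve the
coordinates in the set I of the directions that occur.  As 0 is the only vector
of C whose coordinates in I vanish, x + r (- x) = 0 for x in C, so C is
symmetric and contains a neighborhood of 0. *)
Lemma retraction_unpaired_side C r : convex_polyhedral_cone C ->
    C `<` [set: 'rV[R]_n] -> interior C !=set0 -> retraction C r ->
  exists s i, [/\ s * s = 1, open_side s i `&` C !=set0 &
                  ~ (open_side (- s) i `&` C !=set0)].
Proof.
move=> hC [_ CT] [u0 u0C] hr; have [[rC _ _] [_ [_ Cl]]] := (hr, hC).
apply: contrapT => unpaired; apply: CT => y _.
have paired s i : s * s = 1 ->
    open_side s i `&` C !=set0 -> open_side (- s) i `&` C !=set0.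
  by move=> ss hs; apply: contrapT => hNs; apply: unpaired; exists s, i.
pose I i := open_side (1 : R) i `&` C !=set0.
have II s i : s * s = 1 -> open_side s i `&` C !=set0 -> I i.
  move=> ss; have /eqP : (s - 1) * (s + 1) = 0.
    by rewrite mulrDr mulr1 mulrBl ss; ring.
  rewrite mulf_eq0 subr_eq0 addr_eq0 => /orP[/eqP->//|/eqP->].
  by move=> /paired; rewrite opprK mulrNN mulr1; apply.
have r_coord_le s i x : s * s = 1 -> open_side s i `&` C !=set0 ->
    s * x 0 i <= s * r x 0 i.
  move=> ss [u [us Cu]].
  by apply: (retraction_coord _ _ _ _ _ _ ss hr us) => t; exact: Cl.
have r_coord i x : I i -> r x 0 i = x 0 i.
  move=> Ii; have := r_coord_le 1 i x (mulr1 1) Ii.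
  have := r_coord_le (- 1) i x _ (paired _ _ (mulr1 1) Ii).
  by rewrite !mulN1r !mul1r opprK => /(_ erefl); lra.
(* The vectors k x + u0 are interior, so their norm is attained at a coordinate
   in I, where they agree with u0: the multiples of x are bounded. *)
have I_determines x : C x -> (forall i, I i -> x 0 i = 0) -> x = 0.
  move=> Cx xI.
  have kx (k : nat) : k%:R * `|x| <= 2 * `|u0|.
    have kxu : interior C (k%:R *: x + u0).
      by apply: interior_coneD => //; exact: Cl.
    suff h : `|k%:R *: x + u0| <= `|u0|.
      have := le_trans (lerB_normD (k%:R *: x) u0) h.
      by rewrite normrZ normr_nat; lra.
    have [->|] := eqVneq `|k%:R *: x + u0| 0; first exact: normr_ge0.
    move=> /mx_norm_neq0 [] [k0 i] /=; rewrite ord1 => normE.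
    have imax j : `|(k%:R *: x + u0) 0 j| <= `|(k%:R *: x + u0) 0 i|.
      by rewrite -normE; exact: normv_coord.
    have [s ss sC] := interior_cone_open_side _ _ _ hC kxu imax.
    by rewrite [`|_|]normE !mxE (xI i (II s i ss sC)) mulr0 add0r normv_coord.
  apply/eqP; rewrite -normr_eq0 eq_le normr_ge0 andbT leNgt; apply/negP => x0.
  have := kx (Num.Def.trunc (2 * `|u0| / `|x|)).+1.
  by rewrite leNgt -ltr_pdivrMr // truncnS_gt.
have CN x : C x -> C (- x).
  move=> Cx; suff <- : r (- x) = - x by [].
  apply/eqP; rewrite -addr_eq0; apply/eqP/I_determines.
    by apply: polyhedral_coneD.
  by move=> i Ii; rewrite mxE r_coord // mxE addNr.
have [e e0 eC] : exists2 e : R, 0 < e &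
    forall z : 'rV[R]_n, `|z - 0| < e -> C z.
  apply/interior_normP; rewrite -(addNr u0); apply: interior_coneD => //.
  by apply: CN; exact: interior_subset.
have y0 : 0 < `|y| + e by rewrite ltr_wpDl.
have -> : y = ((`|y| + e) / e) *: ((e / (`|y| + e)) *: y).
  rewrite scalerA; have -> : (`|y| + e) / e * (e / (`|y| + e)) = 1.
    by field; rewrite !gt_eqF.
  by rewrite scale1r.
apply: Cl; last by rewrite divr_ge0 // ltW.
apply: eC; rewrite subr0 normrZ gtr0_norm ?divr_gt0 //.
by rewrite mulrAC ltr_pdivrMr // ltr_pM2l // ltrDl.
Qed.

End retractions_onto_cones.

(** * A criterion for the hyperconvexity of cones *)

Section hyperconvex_cones.
Context {R : realType} {n : nat}.
Implicit Types (x y u v p q : 'rV[R]_n) (s : R) (i j : 'I_n) (C : set 'rV[R]_n).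
Implicit Types (G : set ('rV[R]_n * R)).

Definition ball_meet G : set 'rV[R]_n :=
  [set q | forall z, G z -> `|q - z.1| <= z.2].

Lemma compact_ball_meet G : G !=set0 -> compact (ball_meet G).
Proof.
move=> [z0 Gz0].
have -> : ball_meet G = \bigcap_(z in G) [set q | `|q - z.1| <= z.2] by [].
apply: (subclosed_compact _ (compact_norm_ball z0.1 z0.2)).
  by apply: closed_bigI => z _; exact: closed_norm_ball.
by move=> q; exact.
Qed.

Lemma ball_meet_convex G (t : R) x y : 0 <= t <= 1 ->
  ball_meet G x -> ball_meet G y -> ball_meet G ((1 - t) *: x + t *: y).
Proof.
move=> /andP[t0 t1] Gx Gy z Gz.
have -> : (1 - t) *: x + t *: y - z.1 = (1 - t) *: (x - z.1) + t *: (y - z.1).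
  by apply/rowP => j; rewrite !mxE; ring.
rewrite (le_trans (ler_normD _ _)) // !normrZ !ger0_norm ?subr_ge0 //.
by have := Gx z Gz; have := Gy z Gz; nra.
Qed.

(** Put p = (1 - t) u + t q and w = (1 - t) / t.  As p / t is in the apex,
x = z - p / t is in C for each center z, and q - z = - (x + w u).  The increase
of the i-th coordinate of q - z is harmful only if - s x_i is large; but then,
no vector of C pointing strictly into the side (- s, i), some other coordinate
of x is at least as large as - s x_i in absolute value.  Since w u moves that
coordinate by less than it moves the i-th one, the bound on the former leaves
room for increasing the latter. *)
Lemma apex_ball_meet_raise C G s i u q (t : R) : convex_polyhedral_cone C ->
    s * s = 1 -> open_side s i u -> ~ (open_side (- s) i `&` C !=set0) ->
    G `<=` [set z | C z.1] -> ball_meet G q -> 0 <= t < 1 ->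
    apex C ((1 - t) *: u + t *: q) -> C u ->
  exists2 d : R, 0 < d & ball_meet G (q + (d * s) *: delta_mx 0 i).
Proof.
move=> [hP [_ Cl]] ss us nopp GC Gq /andP[t0 t1] [V /= VC pV] Cu.
have hC : convex_polyhedral_cone C by split=> //; split=> //; exists u.
have CV (a : R) x : C x -> C (x - a *: ((1 - t) *: u + t *: q)).
  move=> Cx; rewrite -scaleNr; apply: polyhedral_coneD => //.
  by apply: VC; exact: memvZ.
have CN x : C x -> s * x 0 i < 0 ->
    exists2 j, j != i & - (s * x 0 i) <= `|x 0 j|.
  move=> Cx xi; apply: contrapT => nj; apply: nopp.
  have xi0 : 0 < - (s * x 0 i) by rewrite oppr_gt0.
  exists ((- (s * x 0 i))^-1 *: x); split; last first.
    by apply: Cl; rewrite // invr_ge0 ltW.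
  split=> [|j ji]; rewrite mxE.
    by rewrite mulrCA mulNr mulVf // gt_eqF.
  rewrite normrM normfV (gtr0_norm xi0) mulrC ltr_pdivrMr // mul1r ltNge.
  by apply/negP => xj; apply: nj; exists j.
(* For t = 0 the vector u itself would be in the apex, hence - u in C. *)
have tn0 : t != 0.
  apply: contra_notN nopp => /eqP tE; exists (- u); split.
    split=> [|j ji]; rewrite mxE; first by rewrite mulrNN; exact: us.1.
    by rewrite normrN; exact: us.2.
  have := CV 2 u Cu; rewrite tE subr0 scale1r scale0r addr0.
  by have -> : u - 2 *: u = - u by apply/rowP => j; rewrite !mxE; ring.
have tp : 0 < t by rewrite lt_neqAle eq_sym tn0.
have [e [e0 e1 ue]] := open_side_gap _ _ _ us.
pose w := (1 - t) / t.
have w0 : 0 < w by rewrite divr_gt0 // subr_gt0.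
exists (w * e); first exact: mulr_gt0.
move=> z Gz; have z0 : 0 <= z.2 by rewrite (le_trans _ (Gq z Gz)).
have qz j : `|q 0 j - z.1 0 j| <= z.2.
  by have := le_trans (normv_coord _ j) (Gq z Gz); rewrite !mxE.
pose x := z.1 - t^-1 *: ((1 - t) *: u + t *: q).
have xE j : q 0 j - z.1 0 j = - (x 0 j + w * u 0 j).
  by rewrite /x /w !mxE; field.
have Cx : C x by apply: CV; exact: GC.
apply/normv_leP => // j; rewrite !mxE /=.
have [->|ji] := eqVneq j i; last by rewrite mulr0 addr0.
have qzi : - z.2 <= s * (q 0 i - z.1 0 i).
  have := qz i; rewrite -[X in X <= _]mul1r -(sign_norm1 _ ss) -normrM.
  by move=> /ler_normlP[]; lra.
have -> : q 0 i + w * e * s * 1 - z.1 0 i = s * (s * (q 0 i - z.1 0 i) + w * e).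
  by rewrite mulrDr mulrA ss; ring.
rewrite normrM (sign_norm1 _ ss) mul1r ler_norml; apply/andP; split.
  by rewrite (le_trans qzi) // lerDl ltW // mulr_gt0.
have -> : s * (q 0 i - z.1 0 i) = - (s * x 0 i) - w.
  by rewrite xE mulrN mulrDr mulrCA us.1; ring.
have we : w * e <= w by rewrite ler_piMr // ltW.
have [xi|/(CN x Cx)[j' j'i xj']] := lerP 0 (s * x 0 i); first by lra.
have : `|x 0 j'| <= z.2 + w * `|u 0 j'|.
  have := qz j'; rewrite xE normrN => h.
  have := lerB_normD (x 0 j') (w * u 0 j').
  rewrite [`|w * _|]normrM (gtr0_norm w0).
  by lra.
have : w * (`|u 0 j'| + e) <= w by rewrite ler_piMr ?ue // ltW.
by rewrite mulrDr; lra.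
Qed.

(** Blow up the intersection of the balls from u, as (1 - t) u + t Q.  The last
copy that meets C does so in a point p outside the apex, and the retraction
onto the tangent cone at p shows that it was not the last one unless t = 1.
Restricting the intersection to its part Q with the largest s q_i is what
keeps p away from the apex; retractions onto cones containing u respect
this restriction. *)
Lemma cone_hyperconvex C s i u : convex_polyhedral_cone C ->
    (forall p, (boundary C `\` apex C) p ->
       exists r, retraction (tangent_cone C p) r) ->
    s * s = 1 -> open_side s i u -> C u -> ~ (open_side (- s) i `&` C !=set0) ->
  hyperconvex C.
Proof.
move=> hC tanC ss us Cu nopp G GC Gm; have [hP [_ Cl]] := hC.
have [G0|/nonemptyPn G0] := pselect (G !=set0); last first.
  by exists u => // z; rewrite G0.
have cG := compact_ball_meet G G0.
have coordc : continuous (fun q : 'rV[R]_n => s * q 0 i).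
  by move=> q; exact: (cvgM (cvg_cst _) (@coord_continuous R 1 n 0 i q)).
have [q0 Gq0 q0max] : exists2 q0, ball_meet G q0 &
    forall q, ball_meet G q -> s * q 0 i <= s * q0 0 i.
  have [q _ Gq] := hyperconvexT G (fun _ _ => I) Gm.
  have [|q0 /set_mem Gq0 h] :=
    compact_EVT_max _ cG (continuous_subspaceT coordc); first by exists q.
  by exists q0 => // q1 Gq1; apply: h; exact: mem_set.
pose Q := ball_meet G `&` [set q | s * q0 0 i <= s * q 0 i].
have Qq0 : Q q0 by split => /=.
have cQ : compact Q.
  apply: compact_closedI => //.
  apply: ((continuous_closedP _).1 coordc [set a | s * q0 0 i <= a]).
  exact: closed_ge.
have Qconv (t : R) x y : 0 <= t <= 1 -> Q x -> Q y -> Q ((1 - t) *: x + t *: y).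
  move=> /andP[t0 t1] [Gx xi] [Gy yi]; split.
    by apply: ball_meet_convex => //; rewrite t0.
  by rewrite /= !mxE; move: xi yi => /=; nra.
pose f (a : R * 'rV[R]_n) := (1 - a.1) *: u + a.1 *: a.2.
pose K := (`[0, 1]%classic `*` Q) `&` (f @^-1` C).
have cK : compact K.
  apply: compact_closedI.
    by apply: compact_setX; [exact: segment_compact|].
  have fc : continuous f.
    move=> a; apply: cvgD; apply: cvgZ.
    - exact: (cvgB (cvg_cst _) cvg_fst).
    - exact: cvg_cst.
    - exact: cvg_fst.
    - exact: cvg_snd.
  by apply: ((continuous_closedP f).1 fc C); exact: closed_polyhedron.
have K0 : K !=set0.
  exists (0, q0); split; last by rewrite /f /= subr0 scale1r scale0r addr0.
  by split=> //=; rewrite in_itv /= lexx ler01.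
have fstc : continuous (fst : R * 'rV[R]_n -> R) by move=> a; exact: cvg_fst.
have [[t q] /set_mem Ktq tmax] :=
  compact_EVT_max K0 cK (continuous_subspaceT fstc).
case: Ktq tmax => -[/= t01 Qq] Cf tmax.
move: t01; rewrite in_itv /= => /andP[t0 t1].
have [t1'|t1'] := eqVneq t 1.
  exists q; last exact: Qq.1.
  by move: Cf; rewrite /f /= t1' subrr scale0r add0r scale1r.
have tlt1 : t < 1 by rewrite lt_neqAle t1'.
set p := f (t, q) in Cf.
suff [q' Qq' [b /andP[b0 b1] Cb]] : exists2 q', Q q' &
    exists2 b : R, 0 < b <= 1 & C ((1 - b) *: p + b *: q').
  (* The point of C on the segment from p to q' is (1 - t') u + t' q'' with q''
     in Q on the segment from q to q'. *)
  pose t' := 1 - (1 - b) * (1 - t).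
  have tt' : t < t' by rewrite /t'; nra.
  have t'0 : 0 < t' by exact: le_lt_trans tt'.
  have t'1 : t' <= 1 by rewrite /t'; nra.
  have Kt' : K (t', (1 - b / t') *: q + (b / t') *: q').
    split=> /=.
      split=> /=; first by rewrite in_itv /= (ltW t'0).
      apply: Qconv => //; rewrite divr_ge0 ?(ltW b0) ?(ltW t'0) //=.
      by rewrite ler_pdivrMr // mul1r /t'; nra.
    suff -> : f (t', (1 - b / t') *: q + (b / t') *: q') =
        (1 - b) *: p + b *: q' by [].
    have t'E : t' - b = (1 - b) * t by rewrite /t'; ring.
    rewrite /f /p /f /= scalerDr !scalerA mulrBr mulr1 mulrCA.
    rewrite divff ?gt_eqF // mulr1 t'E.
    by apply/rowP => j; rewrite !mxE /t'; ring.
  by have := tmax _ (mem_set Kt'); rewrite /= leNgt tt'.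
have [pint|pnint] := pselect (interior C p).
  have [e e0 eC] := (interior_normP _ _).1 pint.
  have d0 : 0 < e + `|q - p| by rewrite ltr_pwDl.
  exists q => //; exists (e / (e + `|q - p|)).
    by rewrite divr_gt0 //= ler_pdivrMr // mul1r lerDl.
  apply: eC.
  have -> : (1 - e / (e + `|q - p|)) *: p + e / (e + `|q - p|) *: q - p =
      e / (e + `|q - p|) *: (q - p) by apply/rowP => j; rewrite !mxE; ring.
  rewrite normrZ gtr0_norm ?divr_gt0 // mulrAC ltr_pdivrMr // ltr_pM2l //.
  by rewrite ltrDr.
have pbd : (boundary C `\` apex C) p.
  split; first by split=> //; exact: subset_closure.
  move=> pap; have t01 : 0 <= t < 1 by rewrite t0.
  have [d d0 Gd] :=
    apex_ball_meet_raise _ _ _ _ _ _ _ hC ss us nopp GC Qq.1 t01 pap Cu.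
  have := q0max _ Gd; rewrite !mxE !eqxx mulr1 mulrDr mulrCA ss mulr1.
  by have := Qq.2 => /=; lra.
have [r hr] := tanC p pbd; have [rT rid rlip] := hr.
have CT : C `<=` tangent_cone C p by apply: sub_tangent_cone.
exists (r q); last exact: tangent_cone_segment.
split=> [z Gz|/=].
  by rewrite -(rid z.1 (CT _ (GC _ Gz))) (le_trans (rlip _ _)) // Qq.1.
apply: le_trans Qq.2 _; apply: (retraction_coord _ _ _ _ _ _ ss hr us) => a a0.
by apply: CT; exact: Cl.
Qed.

End hyperconvex_cones.

(** * Injective convex polyhedral cones *)

Theorem theorem1p2 (R : realType) (n : nat) (C : set 'rV[R]_n)
  (hC : convex_polyhedral_cone C)
  (hproper : C `<` [set: 'rV[R]_n])
  (hint : interior C !=set0) :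
  injective_metric (set_type C) <->
  (forall p, (boundary C `\` apex C) p ->
     injective_metric (set_type (tangent_cone C p))) /\
  (exists2 F, Facets_star (cube n) C F &
     ~ Facets_star (cube n) C [set - x | x in F]).
Proof.
have NsNs (s : R) : s * s = 1 -> - s * - s = 1 by rewrite mulrNN.
split=> [/injective_retraction[r hr]|[tanC [F FC NFC]]].
  split=> [p [[clp _] _]|].
    have Cp : C p by apply: (closed_polyhedron _ hC.1).
    exact/hyperconvex_injective/(tangent_cone_hyperconvex _ _ _ hC.1 Cp hr).
  have [s [i [ss sC nsC]]] := retraction_unpaired_side _ _ hC hproper hint hr.
  exists (side s i); first exact/Facets_star_side.
  by rewrite opp_side => /(Facets_star_side _ _ _ (NsNs _ ss)).
have [s [i [ss FE]]] := facet_side _ FC.1; move: FC NFC; rewrite FE opp_side.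
move=> /(Facets_star_side _ _ _ ss)[u [us Cu]] NsC.
apply/hyperconvex_injective/(cone_hyperconvex _ s i u hC) => //.
  by move=> p /tanC/injective_retraction.
by move=> /(Facets_star_side _ _ _ (NsNs _ ss)).
Qed.
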